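(* Let $d\ge 1$ and let $G$ be a finite $d$-regular (simple, unweighted, undirected) graph. Then there is no partition of the edge set of $G$ into two sets such that the corresponding edge-induced subgraphs $G_1$ and $G_2$ (both on the vertex set of $G$) satisfy $$-\frac{1}{2\sqrt d}\,L_G\preccurlyeq L_{G_1}-L_{G_2}\preccurlyeq\frac{1}{2\sqrt d}\,L_G.$$
   Context: The Laplacian of a graph $G=(V,E)$ is $L_G=\sum_{(u,v)\in E}(\chi_u-\chi_v)(\chi_u-\chi_v)^\top$, where $\chi_u\in\mathbb{R}^V$ is the indicator vector of $u$ and each undirected edge is counted once. For symmetric real matrices, $A\preccurlyeq B$ means that $B-A$ is positive semidefinite. *)

(* Defs.v *)
From HB Require Import structures.
From mathcomp Require Import all_boot all_order all_algebra.
From mathcomp Require Import reals.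

Set Implicit Arguments.
Unset Strict Implicit.
Unset Printing Implicit Defensive.

Import Order.TTheory GRing.Theory Num.Theory.
Local Open Scope ring_scope.

(* An edge is the two-element set of its endpoints. *)
Record sgraph (V : finType) := SGraph {
  edges : {set {set V}};
  card_edge : forall e, e \in edges -> #|e| = 2%N
}.

Definition degree (V : finType) (G : sgraph V) (v : V) : nat :=
  #|[set e in edges G | v \in e]|.

Definition regular (V : finType) (d : nat) (G : sgraph V) : Prop :=
  forall v : V, degree G v = d.

Lemma card_edge_setI (V : finType) (G : sgraph V) (F : {set {set V}}) e :
  e \in edges G :&: F -> #|e| = 2%N.
Proof. by case/setIP=> eG _; exact: card_edge eG. Qed.

(* The vertex set is unchanged: vertices not covered by F stay, as isolated
   vertices. *)
Definition edge_subgraph (V : finType) (G : sgraph V) (F : {set {set V}}) :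
  sgraph V := SGraph (@card_edge_setI V G F).

(* R^V is represented by column vectors of size #|V|, the coordinate of
   v : V being the one of index enum_rank v. *)
Definition chi (R : realType) (V : finType) (u : V) : 'cV[R]_#|V| :=
  \col_i (enum_val i == u)%:R.

(* The condition enum_rank u < enum_rank v picks one of the two orientations
   of each edge; the summand does not depend on the orientation. *)
Definition laplacian (R : realType) (V : finType) (G : sgraph V) :
  'M[R]_#|V| :=
  \sum_(u : V) \sum_(v : V | ([set u; v] \in edges G)
                             && (enum_rank u < enum_rank v)%N)
    (chi R u - chi R v) *m (chi R u - chi R v)^T.

Definition psdmx (R : realType) (n : nat) (A : 'M[R]_n) : Prop :=
  A^T = A /\ forall x : 'cV[R]_n, 0 <= (x^T *m A *m x) 0 0.

Definition loewner_le (R : realType) (n : nat) (A B : 'M[R]_n) : Prop :=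
  psdmx (B - A).

(* Main.v *)
Require Import Defs.
From HB Require Import structures.
From mathcomp Require Import all_boot all_order all_algebra.
From mathcomp Require Import reals.
From mathcomp Require Import ring lra.

Set Implicit Arguments.
Unset Strict Implicit.
Unset Printing Implicit Defensive.

Import Order.TTheory GRing.Theory Num.Theory.
Local Open Scope ring_scope.

(** Write [n] for the number of vertices and suppose that
    [M = L_{G1} - L_{G2}] lies between [- L_G / (2 sqrt d)] and
    [L_G / (2 sqrt d)].

    Since [(a - b)^2 <= 2 a^2 + 2 b^2], the Laplacian of a [d]-regular graph is
    at most [2 d] times the identity ([laplacian_form_le]), so
    [|x^T M x| <= sqrt d |x|^2] for every [x].  As [M] is symmetric, this bound
    on its quadratic form bounds it as an operator: [|M x|^2 <= d |x|^2]
    ([quadratic_form_operator_bound]).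

    Let [v] be a vertex.  Off the diagonal, the [v]-th column of [M] has an
    entry 1 or -1 for each of the [d] neighbours of [v], so
    [|M chi_v|^2 >= d] ([signed_laplacian_col_ge]).  A Laplacian kills the
    constant vectors ([laplacian_const]), so [chi_v] may be replaced by its
    projection [chi_v - 1/n] orthogonal to them, which has the same image
    under [M] but squared norm [1 - 1/n < 1] ([dot_centered_chi]).  Hence
    [d <= |M (chi_v - 1/n)|^2 <= d (1 - 1/n) < d], a contradiction. *)

(** * Inner products and quadratic forms of column vectors *)

Definition dot (R : realType) (n : nat) (x y : 'cV[R]_n) : R :=
  (x^T *m y) 0 0.

Lemma dotE (R : realType) (n : nat) (x y : 'cV[R]_n) :
  dot x y = \sum_i x i 0 * y i 0.
Proof. by rewrite /dot mxE; apply: eq_bigr => i _; rewrite mxE. Qed.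

Lemma dotC (R : realType) (n : nat) (x y : 'cV[R]_n) : dot x y = dot y x.
Proof. by rewrite !dotE; apply: eq_bigr => i _; rewrite mulrC. Qed.

Lemma dotDl (R : realType) (n : nat) (x y z : 'cV[R]_n) :
  dot (x + y) z = dot x z + dot y z.
Proof. by rewrite /dot linearD mulmxDl mxE. Qed.

Lemma dotZl (R : realType) (n : nat) (a : R) (x z : 'cV[R]_n) :
  dot (a *: x) z = a * dot x z.
Proof. by rewrite /dot linearZ -scalemxAl mxE. Qed.

Lemma dotNl (R : realType) (n : nat) (x z : 'cV[R]_n) :
  dot (- x) z = - dot x z.
Proof. by rewrite -scaleN1r dotZl mulN1r. Qed.

Lemma dotDr (R : realType) (n : nat) (x y z : 'cV[R]_n) :
  dot z (x + y) = dot z x + dot z y.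
Proof. by rewrite dotC dotDl !(dotC z). Qed.

Lemma dotZr (R : realType) (n : nat) (a : R) (x z : 'cV[R]_n) :
  dot z (a *: x) = a * dot z x.
Proof. by rewrite dotC dotZl (dotC z). Qed.

Lemma dotNr (R : realType) (n : nat) (x z : 'cV[R]_n) :
  dot z (- x) = - dot z x.
Proof. by rewrite dotC dotNl (dotC z). Qed.

Lemma dot_mulmx_sym (R : realType) (n : nat) (A : 'M[R]_n) (x y : 'cV[R]_n) :
  A^T = A -> dot x (A *m y) = dot (A *m x) y.
Proof. by move=> symA; rewrite /dot trmx_mul symA mulmxA. Qed.

Lemma loewner_sandwich_form (R : realType) (n : nat) (A L : 'M[R]_n) (e : R) :
    loewner_le (- e *: L) A -> loewner_le A (e *: L) ->
  forall x, `|dot x (A *m x)| <= e * dot x (L *m x).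
Proof.
move=> [_ lo] [_ hi] x; have := lo x; have := hi x.
rewrite -!mulmxA -!/(dot _ _) !mulmxBl -!scalemxAl !dotDr !dotNr !dotZr.
by move=> q_hi q_lo; rewrite ler_norml; apply/andP; split; lra.
Qed.

(** Polarization: for [y = A x] the form takes at [c x + y] and [c x - y]
    values that differ by [4 c |y|^2], while the parallelogram law bounds the
    difference by [2 c (c^2 |x|^2 + |y|^2)].  This avoids diagonalizing [A]. *)
Lemma quadratic_form_operator_bound (R : realType) (n : nat) (A : 'M[R]_n)
    (c : R) :
    A^T = A -> 0 < c -> (forall x, `|dot x (A *m x)| <= c * dot x x) ->
  forall x, dot (A *m x) (A *m x) <= c ^+ 2 * dot x x.
Proof.
move=> symA c_gt0 bndA x; set y := A *m x.
have /ler_normlP[_ hp] := bndA (c *: x + y).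
have /ler_normlP[hm _] := bndA (c *: x - y).
move: hp hm; rewrite !mulmxDr mulmxN -scalemxAr -/y.
rewrite !(dotDl, dotDr, dotZl, dotZr, dotNl, dotNr).
rewrite (dot_mulmx_sym x y symA) -/y (dotC y x) => hp hm.
rewrite -(ler_pM2l c_gt0); nra.
Qed.

(** * Laplacians *)

Lemma edge_neq (V : finType) (G : sgraph V) (u v : V) :
  [set u; v] \in edges G -> u != v.
Proof. by move/card_edge; rewrite cards2; case: (u != v). Qed.

(** [w |-> {v, w}] is a bijection from the neighbours of [v] to the edges at
    [v]. *)
Lemma card_neighbours (V : finType) (G : sgraph V) (v : V) :
  #|[pred w | [set v; w] \in edges G]| = degree G v.
Proof.
rewrite /degree -(card_in_imset (f := fun w => [set v; w])); last first.
  move=> w w' /edge_neq vw _ /setP/(_ w); rewrite !inE eqxx orbT.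
  by rewrite eq_sym (negPf vw) /= => /esym/eqP.
apply: eq_card => e; rewrite !inE; apply/imsetP/andP => [[w we ->]|[eG ve]].
  by rewrite set21.
have /eqP/cards2P[a [b [_ eE]]] := card_edge eG.
move: ve eG; rewrite eE !inE => /orP[]/eqP-> abG; first by exists b.
by exists a; rewrite ?inE // setUC.
Qed.

(** Each edge has two orientations, of which exactly one has increasing
    ranks. *)
Lemma sum_orientations (V : finType) (W : nmodType) (G : sgraph V)
    (g : V -> V -> W) :
  \sum_u \sum_(v | ([set u; v] \in edges G)
                   && (enum_rank u < enum_rank v)%N) (g u v + g v u)
  = \sum_u \sum_(v | [set u; v] \in edges G) g u v.
Proof.
have -> : \sum_u \sum_(v | [set u; v] \in edges G) g u v =
    \sum_u \sum_(v | ([set u; v] \in edges G)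
                     && (enum_rank u < enum_rank v)%N) g u v +
    \sum_u \sum_(v | ([set u; v] \in edges G)
                     && ~~ (enum_rank u < enum_rank v)%N) g u v.
  rewrite -big_split; apply: eq_bigr => u _.
  by rewrite (bigID (fun v : V => (enum_rank u < enum_rank v)%N)).
under eq_bigr do rewrite big_split /=.
rewrite big_split /=; congr (_ + _).
rewrite (exchange_big_dep predT) //=; apply: eq_bigr => u _.
apply: eq_bigl => v; rewrite setUC; case uvG: (_ \in _) => //=.
rewrite -leqNgt [RHS]leq_eqVlt (inj_eq val_inj) (inj_eq enum_rank_inj).
by rewrite eq_sym (negPf (edge_neq uvG)).
Qed.

Section Laplacian.
Variables (R : realType) (V : finType).
Implicit Types (G : sgraph V) (x : 'cV[R]_#|V|).

Lemma laplacian_sym G : (laplacian R G)^T = laplacian R G.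
Proof.
rewrite /laplacian linear_sum; apply: eq_bigr => u _.
rewrite linear_sum; apply: eq_bigr => v _.
by rewrite /= trmx_mul trmxK.
Qed.

Lemma dot_chi (u : V) x : dot (chi R u) x = x (enum_rank u) 0.
Proof.
rewrite dotE (bigD1 (enum_rank u)) //= mxE enum_rankK eqxx mul1r big1 ?addr0//.
by move=> i ne; rewrite mxE (can2_eq enum_valK enum_rankK) (negPf ne) mul0r.
Qed.

Lemma laplacian_const G : laplacian R G *m const_mx 1 = 0 :> 'cV_#|V|.
Proof.
rewrite /laplacian mulmx_suml big1 // => u _.
rewrite mulmx_suml big1 // => v _.
rewrite -mulmxA; set z := _^T *m _.
suff -> : z = 0 by rewrite mulmx0.
apply/matrixP => i j; rewrite !ord1 [RHS]mxE -/(dot _ _).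
by rewrite dotDl dotNl !dot_chi !mxE subrr.
Qed.

(** Splitting [(chi_u - chi_v) (chi_u - chi_v)^T] as
    [chi_u (chi_u - chi_v)^T + chi_v (chi_v - chi_u)^T] turns the sum over
    edges into a sum over all orientations. *)
Lemma laplacian_oriented G :
  laplacian R G = \sum_u \sum_(v | [set u; v] \in edges G)
                    chi R u *m (chi R u - chi R v)^T.
Proof.
rewrite -sum_orientations; apply: eq_bigr => u _; apply: eq_bigr => v _.
by rewrite -[X in _ + _ *m X^T]opprB linearN mulmxN mulmxBl.
Qed.

Lemma laplacian_offdiag G (u v : V) :
  u != v ->
  laplacian R G (enum_rank u) (enum_rank v) = - ([set u; v] \in edges G)%:R.
Proof.
move=> uv; rewrite laplacian_oriented summxE (bigD1 u) //=.
rewrite [X in _ + X]big1 ?addr0 => [|w wu]; last first.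
  rewrite summxE big1 // => w' _.
  by rewrite mxE big_ord1 !mxE enum_rankK eq_sym (negPf wu) mul0r.
rewrite summxE; under eq_bigr => w _.
  rewrite mxE big_ord1 !mxE !enum_rankK eqxx mul1r (eq_sym v u) (negPf uv) sub0r.
over.
rewrite sumrN; congr (- _); rewrite big_mkcond (bigD1 v) //= eqxx.
rewrite big1 ?addr0 => [|w wv]; first by case: (_ \in _).
by rewrite eq_sym (negPf wv) if_same.
Qed.

Lemma laplacian_formE G x :
  dot x (laplacian R G *m x) =
  \sum_(u : V) \sum_(v : V | ([set u; v] \in edges G)
                             && (enum_rank u < enum_rank v)%N)
    (x (enum_rank u) 0 - x (enum_rank v) 0) ^+ 2.
Proof.
rewrite /dot mulmxA /laplacian mulmx_sumr mulmx_suml summxE.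
apply: eq_bigr => u _; rewrite mulmx_sumr mulmx_suml summxE.
apply: eq_bigr => v _; rewrite mulmxA -mulmxA mxE big_ord1.
by rewrite -!/(dot _ _) (dotC x) !(dotDl, dotNl) !dot_chi.
Qed.

(** [(a - b)^2 <= 2 a^2 + 2 b^2] charges each edge to its two endpoints, and
    every vertex is charged [d] times. *)
Lemma laplacian_form_le G (d : nat) x :
  regular d G -> dot x (laplacian R G *m x) <= 2 * d%:R * dot x x.
Proof.
move=> regG; rewrite laplacian_formE.
set y := fun u : V => x (enum_rank u) 0.
apply: (@le_trans _ _ (\sum_u \sum_(v | ([set u; v] \in edges G)
     && (enum_rank u < enum_rank v)%N) (2 * y u ^+ 2 + 2 * y v ^+ 2))).
  apply: ler_sum => u _; apply: ler_sum => v _; rewrite -/(y u) -/(y v).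
  (* The difference of the two sides is [(y u + y v) ^+ 2]. *)
  have := sqr_ge0 (y u + y v); nra.
rewrite (sum_orientations G (fun u _ => 2 * y u ^+ 2)).
rewrite dotE mulr_sumr [leRHS](reindex enum_rank) /=; last first.
  exact/onW_bij/enum_rank_bij.
apply: ler_sum => u _; rewrite sumr_const card_neighbours regG.
by rewrite -mulr_natr /y expr2; lra.
Qed.

(** * The signed Laplacian of an edge bipartition *)

Definition signed_laplacian G (E1 E2 : {set {set V}}) : 'M[R]_#|V| :=
  laplacian R (edge_subgraph G E1) - laplacian R (edge_subgraph G E2).

Lemma signed_laplacian_sym G E1 E2 :
  (signed_laplacian G E1 E2)^T = signed_laplacian G E1 E2.
Proof. by rewrite linearB /= !laplacian_sym. Qed.

Lemma signed_laplacian_const G E1 E2 :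
  signed_laplacian G E1 E2 *m const_mx 1 = 0 :> 'cV_#|V|.
Proof. by rewrite mulmxBl !laplacian_const subrr. Qed.

(** The diagonal entry, which is the difference of the degrees of [v] in the
    two parts, only adds to the norm of the column. *)
Lemma signed_laplacian_col_ge G (E1 E2 : {set {set V}}) (v : V) :
    E1 :|: E2 = edges G -> [disjoint E1 & E2] ->
  (degree G v)%:R <= dot (signed_laplacian G E1 E2 *m chi R v)
                         (signed_laplacian G E1 E2 *m chi R v).
Proof.
move=> EU Edisj; set M := signed_laplacian G E1 E2.
have col_M i : (M *m chi R v) i 0 = M i (enum_rank v).
  rewrite mxE (bigD1 (enum_rank v)) //= [chi _ _ _ _]mxE enum_rankK eqxx mulr1.
  rewrite big1 ?addr0 //; move=> j ne.
  by rewrite [chi _ _ _ _]mxE (can2_eq enum_valK enum_rankK) (negPf ne) mulr0.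
rewrite dotE (reindex enum_rank) /=; last exact/onW_bij/enum_rank_bij.
under eq_bigr do rewrite !col_M.
(* Each neighbour of [v] contributes 1 to the bound, any other row 0. *)
rewrite -card_neighbours -sum1_card natr_sum big_mkcond /=.
apply: ler_sum => w _; case: ifP => [|_]; last exact: sqr_ge0.
rewrite inE => vwG; have vw := edge_neq vwG.
rewrite mxE [X in _ + X]mxE !laplacian_offdiag 1?eq_sym // /= !in_setI.
rewrite (setUC [set w]) vwG /=.
(* The entry is -1 if the edge lies in [E1] and 1 if it lies in [E2]. *)
have : [set v; w] \in E1 :|: E2 by rewrite EU.
rewrite inE; case vw1: (_ \in E1) => /=.
  by move=> _; rewrite (disjointFr Edisj vw1) /= mulr1n mulr0n; lra.
by move=> ->; rewrite mulr1n mulr0n; lra.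
Qed.

(** Pythagoras: [chi_v] has norm 1, and its component along the constant
    vectors has squared norm [1/n]. *)
Lemma dot_centered_chi (v : V) :
  let x := chi R v - #|V|%:R^-1 *: const_mx 1 in
  dot x x = 1 - #|V|%:R^-1.
Proof.
have n_neq0 : #|V|%:R != 0 :> R.
  by rewrite pnatr_eq0 -lt0n; apply/card_gt0P; exists v.
rewrite /= !(dotDl, dotDr, dotNl, dotNr, dotZl, dotZr).
rewrite (dotC (const_mx 1) (chi R v)) !dot_chi !mxE enum_rankK eqxx.
have -> : dot (const_mx 1 : 'cV_#|V|) (const_mx 1) = #|V|%:R :> R.
  rewrite dotE; under eq_bigr do rewrite !mxE mulr1.
  by rewrite sumr_const card_ord.
by rewrite mulVf //=; ring.
Qed.

End Laplacian.

Theorem fact2p2 (R : realType) (d : nat) (hd : (1 <= d)%N)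
    (V : finType) (hV : (0 < #|V|)%N) (G : sgraph V) (hG : regular d G) :
  ~ exists E1 E2 : {set {set V}},
      [/\ E1 :|: E2 = edges G,
          [disjoint E1 & E2],
          loewner_le (- (1 / (2 * Num.sqrt d%:R)) *: laplacian R G)
            (laplacian R (edge_subgraph G E1) - laplacian R (edge_subgraph G E2))
        & loewner_le
            (laplacian R (edge_subgraph G E1) - laplacian R (edge_subgraph G E2))
            ((1 / (2 * Num.sqrt d%:R)) *: laplacian R G)].
Proof.
case=> E1 [E2 [EU Edisj lo hi]].
have /card_gt0P[v _] := hV.
have d_gt0 : 0 < d%:R :> R by rewrite ltr0n.
have sqrt_d_gt0 : 0 < Num.sqrt d%:R :> R by rewrite sqrtr_gt0.
have formM x : `|dot x (signed_laplacian R G E1 E2 *m x)|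
               <= Num.sqrt d%:R * dot x x.
  apply: (le_trans (loewner_sandwich_form lo hi x)).
  rewrite mul1r ler_pdivrMl ?mulr_gt0 //.
  have -> : 2 * Num.sqrt d%:R * (Num.sqrt d%:R * dot x x)
            = 2 * d%:R * dot x x.
    by rewrite -[in RHS](sqr_sqrtr (ltW d_gt0)); ring.
  exact: laplacian_form_le.
have := quadratic_form_operator_bound (signed_laplacian_sym R G E1 E2)
          sqrt_d_gt0 formM
          (chi R v - #|V|%:R^-1 *: const_mx 1).
rewrite dot_centered_chi (sqr_sqrtr (ltW d_gt0)).
rewrite mulmxBr -scalemxAr signed_laplacian_const scaler0 subr0 => le_d.
have := le_trans (signed_laplacian_col_ge R v EU Edisj) le_d.
rewrite hG => d_le; have : 0 < d%:R * #|V|%:R^-1 :> R.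
  by rewrite mulr_gt0 // invr_gt0 ltr0n.
lra.
Qed.
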